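(* Let $X$ be a proper geodesic metric space and fix $x_0\in X$. Then each coarse ray $\alpha:\mathbb{R}_{\ge0}\to X$ is close to some proper Lipschitz ray $\alpha^*_{x_0}:\mathbb{R}_{\ge0}\to X$ rooted at $x_0$, that is, with $\alpha^*_{x_0}(0)=x_0$. As such, each element of $\pi_0^{\mathrm{Crs}}(X)$ may be represented by an $x_0$-rooted proper Lipschitz ray.
   Context: A metric space is proper if its closed bounded subsets are exactly its compact subsets, and geodesic if any two points $x,x'$ are joined by an isometric embedding of $[0,d_X(x,x')]$ starting at $x$ and ending at $x'$. A map $f:X\to Y$ of metric spaces is controlled if for every $R>0$ there is $S>0$ such that $d_X(x,x')<R$ implies $d_Y(f(x),f(x'))<S$; proper if preimages of bounded sets are bounded; coarse if controlled and proper. Maps $f,g:X\to Y$ are close if $\sup_x d_Y(f(x),g(x))<\infty$. A coarse (respectively proper Lipschitz) ray in $X$ is a coarse (respectively proper Lipschitz) map $\mathbb{R}_{\ge0}\to X$. For a coarse map $q:X\to\mathbb{R}_{\ge0}$, let $I_qX=\{(x,t)\in X\times\mathbb{R}_{\ge0}:t\le q(x)\}$ with the restriction of a product metric such as the max metric. Coarse maps $f,g:X\to Y$ are coarse homotopic if there are coarse maps $q:X\to\mathbb{R}_{\ge0}$ and $H:I_qX\to Y$ with $H(x,0)=f(x)$, $H(x,q(x))=g(x)$ for all $x$; this is an equivalence relation. $\pi_0^{\mathrm{Crs}}(X)$ is the set of coarse homotopy classes of coarse rays in $X$. *)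

(* Defs.v *)
From HB Require Import structures.
From mathcomp Require Import all_boot all_order all_algebra.
From mathcomp Require Import all_classical all_reals all_analysis.
Set Implicit Arguments.
Unset Strict Implicit.
Unset Printing Implicit Defensive.
Import Order.TTheory GRing.Theory Num.Theory.
Import numFieldNormedType.Exports.
Local Open Scope classical_set_scope.
Local Open Scope ring_scope.

Section MetricInstances.
Context {R : realType}.

Definition nonneg_dist (s t : {nonneg R}) : R := `|s%:num - t%:num|.

Let nonneg_distxx s : nonneg_dist s s = 0.
Proof. by rewrite /nonneg_dist subrr normr0. Qed.

Let nonneg_dist_eq0 s t : nonneg_dist s t = 0 -> s = t.
Proof. by move=> /normr0_eq0/eqP; rewrite subr_eq0 => /eqP/val_inj. Qed.

Let nonneg_dist_sym s t : nonneg_dist s t = nonneg_dist t s.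
Proof. by rewrite /nonneg_dist distrC. Qed.

Let nonneg_dist_triangle t s u :
  nonneg_dist s u <= nonneg_dist s t + nonneg_dist t u.
Proof. exact: ler_distD. Qed.

(* {nonneg R} unfolds to {itv R & `[0, +oo[}, on which instances are keyed. *)
HB.instance Definition _ := isMetric.Build R {itv R & `[0, +oo[}
  nonneg_distxx nonneg_dist_eq0 nonneg_dist_sym nonneg_dist_triangle.

(* The max metric; it induces the library's product pseudometric structure. *)
Section Prod.
Variables X Y : metricType R.

Definition prod_dist (p p' : X * Y) : R :=
  Num.max (mdist p.1 p'.1) (mdist p.2 p'.2).

Let prod_dist_ge0 p p' : 0 <= prod_dist p p'.
Proof. by rewrite /prod_dist le_max mdist_ge0. Qed.

Let prod_dist_eq0 p p' : prod_dist p p' = 0 -> p = p'.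
Proof.
case: p p' => [x y] [x' y'] /eqP; rewrite /prod_dist eq_le /= ge_max.
move=> /andP[/andP[xx' yy'] _].
by congr pair; apply: mdist_positivity; apply/le_anti;
  rewrite mdist_ge0 andbT.
Qed.

Let prod_ball_dist p e : ball p e = [set p' | prod_dist p p' < e].
Proof.
apply/seteqP; split=> p'; rewrite /ball /= /prod_ball /prod_dist !ballEmdist/=.
  by rewrite gt_max => -[-> ->].
by rewrite gt_max => /andP[].
Qed.

HB.instance Definition _ := PseudoMetric_isMetric.Build R (X * Y)%type
  prod_dist_ge0 prod_dist_eq0 prod_ball_dist.
End Prod.

(* The restriction of a metric to a subset. *)
Section Sub.
Variables (X : metricType R) (A : set X).

Definition sub_dist (x y : A) : R := mdist (val x) (val y).

Let sub_dist_ge0 x y : 0 <= sub_dist x y. Proof. exact: mdist_ge0. Qed.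

Let sub_dist_eq0 x y : sub_dist x y = 0 -> x = y.
Proof. by move=> /mdist_positivity/val_inj. Qed.

Let sub_ball_dist x e : ball x e = [set y | sub_dist x y < e].
Proof.
have -> : ball x e = val @^-1` ball (val x) e by [].
by rewrite ballEmdist.
Qed.

HB.instance Definition _ := PseudoMetric_isMetric.Build R (A : Type)
  sub_dist_ge0 sub_dist_eq0 sub_ball_dist.
End Sub.

End MetricInstances.

Section CoarseGeometry.
Context {R : realType}.

Definition metric_bounded (X : metricType R) (A : set X) : Prop :=
  exists M : R, forall x y, A x -> A y -> mdist x y <= M.

Definition proper_space (X : metricType R) : Prop :=
  forall A : set X, closed A /\ metric_bounded A <-> compact A.

(* Only the restriction of gamma to [0, d(x, x')] matters. *)
Definition geodesic_space (X : metricType R) : Prop :=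
  forall x x' : X, exists gamma : R -> X,
    [/\ {in `[0, mdist x x'] &, forall s t,
           mdist (gamma s) (gamma t) = `|s - t|},
        gamma 0 = x & gamma (mdist x x') = x'].

Definition controlled (X Y : metricType R) (f : X -> Y) : Prop :=
  forall r : R, 0 < r -> exists2 s : R, 0 < s &
    forall x x', mdist x x' < r -> mdist (f x) (f x') < s.

Definition proper_map (X Y : metricType R) (f : X -> Y) : Prop :=
  forall B : set Y, metric_bounded B -> metric_bounded (f @^-1` B).

Definition coarse_map (X Y : metricType R) (f : X -> Y) : Prop :=
  controlled f /\ proper_map f.

Definition lipschitz_map (X Y : metricType R) (f : X -> Y) : Prop :=
  exists L : R, forall x x', mdist (f x) (f x') <= L * mdist x x'.

Definition close_maps (T : Type) (Y : metricType R) (f g : T -> Y) : Prop :=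
  (ereal_sup (range (fun x => (mdist (f x) (g x))%:E)) < +oo)%E.

Definition coarse_ray (X : metricType R) (f : {nonneg R} -> X) : Prop :=
  coarse_map f.

Definition proper_lipschitz_ray (X : metricType R) (f : {nonneg R} -> X) :
    Prop :=
  proper_map f /\ lipschitz_map f.

Definition cylinder (X : metricType R) (q : X -> {nonneg R}) :
    set (X * {nonneg R}) :=
  [set p | p.2 <= q p.1].

Definition cyl_point (X : metricType R) (q : X -> {nonneg R}) (x : X)
    (t : {nonneg R}) (tq : t <= q x) : cylinder q :=
  exist _ (x, t) (mem_set (tq : cylinder q (x, t))).

Lemma nonneg0_le (t : {nonneg R}) : 0%:nng <= t.
Proof. by rewrite -num_le /=. Qed.

Definition cyl_start (X : metricType R) (q : X -> {nonneg R}) (x : X) :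
  cylinder q := cyl_point (nonneg0_le (q x)).

Definition cyl_end (X : metricType R) (q : X -> {nonneg R}) (x : X) :
  cylinder q := cyl_point (lexx (q x)).

Definition coarse_homotopic (X Y : metricType R) (f g : X -> Y) : Prop :=
  exists (q : X -> {nonneg R}) (H : cylinder q -> Y),
    [/\ coarse_map q, coarse_map H,
        forall x, H (cyl_start q x) = f x & forall x, H (cyl_end q x) = g x].

Definition ray_class (X : metricType R) (a : {nonneg R} -> X) :
    set ({nonneg R} -> X) :=
  [set b | coarse_ray b /\ coarse_homotopic a b].

Definition pi0_Crs (X : metricType R) : set (set ({nonneg R} -> X)) :=
  [set C | exists2 a, coarse_ray a & C = ray_class a].

End CoarseGeometry.
Arguments pi0_Crs {R} X.

(* Main.v *)
(* A coarse ray moves boundedly between consecutive integers, so joining its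
   values at the integers (with the value at 0 replaced by x0) by constant-speed
   geodesics gives a Lipschitz ray close to it; properness is inherited through
   closeness. Close maps moreover have the same coarse homotopy classes: a
   homotopy H from f to g, lengthened by one unit, remains a coarse map when its
   start is replaced by any map close to f. *)
Require Import Defs.
From mathcomp Require Import all_boot all_order all_algebra.
From mathcomp Require Import all_classical all_reals all_analysis.
From mathcomp Require Import lra.
Import numFieldNormedType.Exports.
Import Order.TTheory GRing.Theory Num.Theory.
Local Open Scope classical_set_scope.
Local Open Scope ring_scope.

Section CloseMaps.
Context {R : realType}.
Implicit Types X Y Z : metricType R.

Lemma ler_dist_mdist X (x x' y y' : X) (a b : R) :
  mdist x y <= a -> mdist x' y' <= b ->
  `|mdist x x' - mdist y y'| <= a + b.
Proof.
move=> xya xyb.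
have := metric_triangle x y x'; have := metric_triangle y y' x'.
have := metric_triangle y x y'; have := metric_triangle x x' y'.
rewrite (metric_sym y x) (metric_sym y' x') ler_norml => *.
by apply/andP; split; lra.
Qed.

Lemma close_mapsP (T : Type) Y (f g : T -> Y) :
  close_maps f g <-> exists K : R, forall x, mdist (f x) (g x) <= K.
Proof.
split=> [|[K fgK]].
  rewrite /close_maps; set S := (X in ereal_sup X) => Sfin.
  have ub x : ((mdist (f x) (g x))%:E <= ereal_sup S)%E.
    by apply: ereal_sup_ubound; exists x.
  case: (ereal_sup S) Sfin ub => [K _ ub|//|_ ub].
    by exists K => x; rewrite -lee_fin.
  (* A supremum of [-oo] forces [T] to be empty, so any bound works. *)
  by exists 0 => x; have := ub x; rewrite leeNy_eq.
apply: (@le_lt_trans _ _ K%:E); last exact: ltry.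
by apply: ge_ereal_sup => _ [x _ <-]; rewrite lee_fin.
Qed.

Lemma close_maps_sym {T : Type} {Y} {f g : T -> Y} :
  close_maps f g -> close_maps g f.
Proof.
by move=> /close_mapsP[K fgK]; apply/close_mapsP; exists K => x;
  rewrite metric_sym.
Qed.

(** Source distances change by at most [c] and target distances by at most [K + K], and coarseness
    survives additive errors. It serves with [phi] the identity and with [phi] a truncation between
    cylinders. *)
Lemma coarse_map_close_comp {X Y Z} (phi : X -> Y) (c : R)
    (F : X -> Z) (G : Y -> Z) :
  (forall x x', `|mdist (phi x) (phi x') - mdist x x'| <= c) ->
  close_maps F (G \o phi) -> coarse_map G -> coarse_map F.
Proof.
move=> phic /close_mapsP[K FGK] [Gctrl Gproper].
have FG x x' : `|mdist (F x) (F x') - mdist (G (phi x)) (G (phi x'))| <= K + K.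
  exact: ler_dist_mdist.
split=> [r r0|B [M BM]].
  (* If [X] is empty, [c] and [K] may be negative; absolute values keep the radii positive. *)
  have [|s s0 Gs] := Gctrl (r + `|c|); first by rewrite ltr_wpDr.
  exists (s + `|K + K|); first by rewrite ltr_wpDr.
  move=> x x' xx'.
  have := phic x x'; rewrite ler_norml => /andP[_ hphi].
  have := ler_norm c => hc; have := ler_norm (K + K) => hK.
  have : mdist (G (phi x)) (G (phi x')) < s by apply: Gs; lra.
  by have := FG x x'; rewrite ler_norml => /andP[_ ?] ?; lra.
(* Properness of [G] bounds the preimage of this set, which contains [phi x] whenever [F x] lies in
   [B]. *)
have : metric_bounded [set G (phi x) | x in F @^-1` B].
  exists (M + (K + K)) => _ _ [x Bx <-] [x' Bx' <-].
  have := FG x x'; rewrite ler_norml => /andP[? _].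
  by have := BM _ _ Bx Bx'; lra.
move=> /Gproper[N GN]; exists (N + c) => x x' Bx Bx'.
have := phic x x'; rewrite ler_norml => /andP[? _].
suff : mdist (phi x) (phi x') <= N by lra.
by apply: GN; [exists x|exists x'].
Qed.

Lemma coarse_map_close {X Y} {f g : X -> Y} :
  close_maps f g -> coarse_map g -> coarse_map f.
Proof.
by apply: (@coarse_map_close_comp _ _ _ id 0) => x x'; rewrite subrr normr0.
Qed.

Lemma nonneg_num_ge0 (t : {nonneg R}) : 0 <= t%:num.
Proof. by []. Qed.

Definition nonneg_succ (t : {nonneg R}) : {nonneg R} := (t%:num + 1)%:nng.

Definition nonneg_nat (n : nat) : {nonneg R} := (n%:R)%:nng.

Lemma ge_min_right (s t : {nonneg R}) : Num.min s t <= t.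
Proof. by rewrite ge_min lexx orbT. Qed.

(* The lengthening by one unit separates the two ends of the cylinder where
   q x = 0, so that the start can be changed without changing the end. *)
Lemma coarse_homotopic_closel X Y (f f' g : X -> Y) :
  close_maps f' f -> coarse_homotopic f g -> coarse_homotopic f' g.
Proof.
move=> /close_mapsP[K f'fK] [q [H [cq cH Hf Hg]]].
pose q' (x : X) := nonneg_succ (q x).
pose trunc (p : cylinder q') : cylinder q :=
  @cyl_point _ _ q (val p).1 (Num.min (val p).2 (q (val p).1))
    (ge_min_right _ _).
(* Only height 0 sees [f']; the top height is positive and is truncated to [q x], where [H] gives
   [g]. *)
pose H' (p : cylinder q') : Y :=
  if (val p).2%:num == 0 then f' (val p).1 else H (trunc p).
have truncE p t : Num.min (val p).2 (q (val p).1) = t ->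
    forall tq, trunc p = @cyl_point _ _ q (val p).1 t tq.
  by move=> e tq; apply: val_inj => /=; rewrite e.
have trunc1 p : mdist (val (trunc p)) (val p) <= 1.
  rewrite /mdist /= /prod_dist ge_max mdistxx ler01 /=.
  have : (val p).2 <= q' (val p).1 by have := set_valP p.
  rewrite -num_le /= => h.
  have -> : mdist (Num.min (val p).2 (q (val p).1)) (val p).2
    = `|Num.min (val p).2%:num (q (val p).1)%:num - (val p).2%:num|.
    by rewrite -num_min.
  by rewrite ler_norml minEle; case: ifP => ?; apply/andP; split; lra.
exists q', H'; split=> [||x|x].
- apply: (coarse_map_close _ cq); apply/close_mapsP; exists 1 => x.
  by rewrite /mdist /= /nonneg_dist /= addrAC subrr add0r normr1.
- apply: (coarse_map_close_comp trunc (1 + 1) _ _ _ _ cH) => [p p'|].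
    exact: ler_dist_mdist (trunc1 p) (trunc1 p').
  (* [H'] and [H \o trunc] differ only at height 0, where their values are [f' x] and [f x]. *)
  apply/close_mapsP; exists `|K| => p; rewrite /H' /=.
  case: eqP => [p0|_]; last by rewrite mdistxx.
  have -> : trunc p = cyl_start q (val p).1.
    apply: truncE; apply: val_inj => /=.
    by rewrite num_min p0 min_l.
  by rewrite Hf; apply: le_trans (f'fK _) (ler_norm _).
- by rewrite /H' /= eqxx.
- rewrite /H' /= gt_eqF ?ltr_wpDl // -Hg; congr H.
  apply: truncE; rewrite /= min_r// -num_le /=; lra.
Qed.

(** The representative enters its class only as the start of homotopies, so replacing the start in
    either direction gives both inclusions. *)
Lemma ray_class_close (X : metricType R) (a b : {nonneg R} -> X) :
  close_maps a b -> ray_class a = ray_class b.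
Proof.
move=> ab; apply/seteqP; split=> c [cc ac]; split=> //.
  exact: coarse_homotopic_closel (close_maps_sym ab) ac.
exact: coarse_homotopic_closel ab ac.
Qed.

End CloseMaps.

Section PiecewiseGeodesicRay.
Context {R : realType} {X : metricType R}.

(** Rescaling time to [[0, 1]] lets each geodesic fill the gap between two consecutive integers. *)
Lemma geodesic_param (x y : X) : geodesic_space X -> exists gamma : R -> X,
  [/\ gamma 0 = x, gamma 1 = y &
      forall s t, 0 <= s <= 1 -> 0 <= t <= 1 ->
        mdist (gamma s) (gamma t) = mdist x y * `|s - t|].
Proof.
move=> /(_ x y)[gamma [iso g0 g1]]; exists (fun s => gamma (mdist x y * s)).
rewrite mulr0 mulr1; split=> // s t /andP[s0 s1] /andP[t0 t1].
have d0 := mdist_ge0 x y.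
by rewrite iso ?in_itv /= ?mulr_ge0 ?ler_piMr // -mulrBr normrM ger0_norm.
Qed.

Lemma piecewise_geodesic_ray (p : nat -> X) (L : R) :
  geodesic_space X -> (forall n, mdist (p n) (p n.+1) <= L) ->
  exists f : {nonneg R} -> X,
    (forall (t : {nonneg R}) n, t%:num = n%:R -> f t = p n) /\
    (forall s t, mdist (f s) (f t) <= L * mdist s t).
Proof.
move=> hgeo pL.
have [gamma gammaP] := choice (fun n => geodesic_param (p n) (p n.+1) hgeo).
have L0 : 0 <= L := le_trans (mdist_ge0 _ _) (pL 0%N).
have gammaL n s t : 0 <= s <= 1 -> 0 <= t <= 1 -> s <= t ->
    mdist (gamma n s) (gamma n t) <= L * (t - s).
  move=> hs ht st; have [_ _ ->//] := gammaP n.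
  by rewrite distrC ger0_norm ?subr_ge0// ler_wpM2r// subr_ge0.
have pnL n m : mdist (p n) (p (n + m)%N) <= L * m%:R.
  elim: m => [|m IH]; first by rewrite addn0 mdistxx mulr0.
  apply: le_trans (metric_triangle _ (p (n + m)%N) _) _.
  by rewrite addnS -natr1 mulrDr mulr1 lerD.
pose frac (t : R) : R := t - (Num.truncn t)%:R.
have frac01 (t : R) : 0 <= t -> 0 <= frac t <= 1.
  move=> /truncn_itv/andP[lt tl]; rewrite /frac; rewrite -natr1 in tl.
  by apply/andP; split; lra.
pose f (t : {nonneg R}) := gamma (Num.truncn t%:num) (frac t%:num).
have fL (s t : {nonneg R}) : s <= t ->
    mdist (f s) (f t) <= L * (t%:num - s%:num).
  rewrite -num_le /= => st; rewrite /f.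
  have := frac01 s%:num (nonneg_num_ge0 s); have := frac01 t%:num (nonneg_num_ge0 t).
  have := le_truncn st; rewrite /frac.
  set n := Num.truncn s%:num; set m := Num.truncn t%:num.
  rewrite leq_eqVlt => /orP[/eqP -> ht hs|nm ht hs].
    apply: le_trans (gammaL _ _ _ hs ht _) _; first by rewrite lerD2r.
    by rewrite ler_wpM2l//; lra.
  (* The detour through [p n.+1] and [p m] splits the path into the rest of piece [n], whole pieces,
     and the start of piece [m]; the three durations add up to [t - s]. *)
  have [_ gn1 _] := gammaP n; have [gm0 _ _] := gammaP m.
  apply: le_trans (metric_triangle _ (p n.+1) _) _.
  apply: le_trans (lerD (lexx _) (metric_triangle _ (p m) _)) _.
  have h1 : mdist (gamma n (s%:num - n%:R)) (p n.+1)
      <= L * (1 - (s%:num - n%:R)).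
    by rewrite -gn1 gammaL// ?ler01 ?lexx//; case/andP: hs.
  have h2 : mdist (p m) (gamma m (t%:num - m%:R)) <= L * (t%:num - m%:R - 0).
    by rewrite -gm0 gammaL// ?ler01 ?lexx//; case/andP: ht.
  have := pnL n.+1 (m - n.+1)%N; rewrite subnKC// natrB// -natr1 => h3.
  apply: le_trans (lerD h1 (lerD h3 h2)) _.
  by rewrite -!mulrDr ler_wpM2l//; lra.
exists f; split=> [t n tn|s t].
  rewrite /f tn /frac; have -> : Num.truncn (n%:R : R) = n by rewrite natrK.
  by rewrite subrr; have [] := gammaP n.
have -> : mdist s t = `|s%:num - t%:num| by [].
have [st|ts] := leP s t.
  by apply: le_trans (fL _ _ st) _; rewrite ler_wpM2l// distrC ler_norm.
rewrite metric_sym.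
by apply: le_trans (fL _ _ (ltW ts)) _; rewrite ler_wpM2l// ler_norm.
Qed.

Lemma coarse_ray_close_lipschitz (x0 : X) (alpha : {nonneg R} -> X) :
  geodesic_space X -> coarse_ray alpha ->
  exists alpha_star : {nonneg R} -> X,
    [/\ proper_lipschitz_ray alpha_star, alpha_star 0%:nng = x0
      & close_maps alpha alpha_star].
Proof.
move=> hgeo calpha; have [ctrl _] := calpha.
(* Control is stated with a strict inequality, so a radius above 1 is taken to cover parameters at
   distance exactly 1. *)
have [//|s s0 alphas] := ctrl 2.
have alpha_close (t t' : {nonneg R}) : `|t%:num - t'%:num| < 2 ->
  mdist (alpha t) (alpha t') <= s by move=> /alphas/ltW.
(* [K] is the cost of moving the root to [x0]. *)
pose K := mdist x0 (alpha (nonneg_nat 0)).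
have K0 : 0 <= K := mdist_ge0 _ _.
pose p n := if n is 0%N then x0 else alpha (nonneg_nat n).
have pK n : mdist (p n) (alpha (nonneg_nat n)) <= K.
  by case: n => [|n]; rewrite ?mdistxx.
have pL n : mdist (p n) (p n.+1) <= K + s.
  apply: le_trans (metric_triangle _ (alpha (nonneg_nat n)) _) _.
  rewrite lerD// alpha_close//= distrC -[n.+1%:R]natr1 addrAC subrr add0r normr1.
  by rewrite ltr1n.
have [f [fp fL]] := piecewise_geodesic_ray p (K + s) hgeo pL.
have af : close_maps alpha f.
  (* With [n] the integer part of [t]: [s] from [alpha t] to [alpha n], [K] from there to [p n], and
     the Lipschitz constant [K + s] from [p n = f n] to [f t]. *)
  apply/close_mapsP; exists (s + (K + (K + s))) => t.
  pose n := Num.truncn t%:num; have /andP[nt tn] := truncn_itv (nonneg_num_ge0 t).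
  have d1 : `|t%:num - n%:R| <= 1.
    by rewrite -natr1 in tn; rewrite ler_norml; apply/andP; split; lra.
  apply: le_trans (metric_triangle _ (alpha (nonneg_nat n)) _) _.
  apply: lerD.
    by apply: alpha_close; apply: le_lt_trans d1 _; rewrite ltr1n.
  apply: le_trans (metric_triangle _ (p n) _) _.
  apply: lerD; first by rewrite metric_sym.
  rewrite -(fp (nonneg_nat n)) // metric_sym.
  apply: le_trans (fL _ _) _.
  by rewrite -[leRHS]mulr1 ler_wpM2l// addr_ge0// ltW.
exists f; split=> //; last exact: (fp _ 0%N).
split; last by exists (K + s).
by have [] := coarse_map_close (close_maps_sym af) calpha.
Qed.

End PiecewiseGeodesicRay.

Theorem corollary6p17 (R : realType) (X : metricType R)
    (hproper : proper_space X) (hgeo : geodesic_space X) (x0 : X) :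
  (forall alpha : {nonneg R} -> X, coarse_ray alpha ->
     exists alpha_star : {nonneg R} -> X,
       [/\ proper_lipschitz_ray alpha_star, alpha_star 0%:nng = x0
         & close_maps alpha alpha_star])
  /\ (forall C : set ({nonneg R} -> X), pi0_Crs X C ->
     exists beta : {nonneg R} -> X,
       [/\ proper_lipschitz_ray beta, beta 0%:nng = x0 & C = ray_class beta]).
Proof.
split=> [alpha|C [alpha calpha ->]].
  exact: coarse_ray_close_lipschitz.
have [beta [pbeta beta0 ab]] := coarse_ray_close_lipschitz x0 alpha hgeo calpha.
by exists beta; split=> //; apply: ray_class_close.
Qed.
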